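(* Let $d\ge 0$ be an integer and let $G$ be a $d$-regular graph that contains no $4$-cycle. If $\kappa(G)\leq\frac{d+1}{2}$, then $\varphi(G)=d+1$. This upper bound for the vertex connectivity is sharp for the Petersen graph, in the sense that the Petersen graph is $d$-regular with $d=3$, contains no $4$-cycle, has vertex connectivity $\frac{d+1}{2}+1=3$, and its b-chromatic number is not $d+1=4$.
   Context: All graphs are finite and simple (undirected, loopless, without multiple edges), with nonempty vertex set. ''Contains no $4$-cycle'' means that $G$ has no subgraph (not necessarily induced) isomorphic to the cycle $C_4$ of length $4$. The vertex connectivity $\kappa(G)$ is the minimum cardinality of a subset $U$ of $V(G)$ such that $G\setminus U$ is either disconnected or a graph with only one vertex (so $\kappa(G)=0$ if $G$ is disconnected). A b-coloring of a graph $G$ by $k$ colors is a proper vertex coloring with $k$ colors in which each of the $k$ color classes contains a vertex that is adjacent to at least one vertex in each of the other $k-1$ color classes. The b-chromatic number $\varphi(G)$ is the largest integer $k$ such that $G$ admits a b-coloring by $k$ colors. *)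

(* Defs.v *)
From mathcomp Require Import all_boot.

Set Implicit Arguments.
Unset Strict Implicit.
Unset Printing Implicit Defensive.

Record sgraph := SGraph {
  vertex :> finType;
  adj : rel vertex;
  adj_sym : symmetric adj;
  adj_irr : irreflexive adj;
  vertex_gt0 : 0 < #|vertex| }.

Arguments adj {s}.

Definition regular (d : nat) (G : sgraph) : Prop :=
  forall x : G, #|[set y : G | adj x y]| = d.

(* [G] has a (not necessarily induced) subgraph isomorphic to [H]. *)
Definition contains (H G : sgraph) : Prop :=
  exists2 f : H -> G, injective f & {homo f : x y / adj x y}.

(* [ordS] is the successor modulo 4. *)
Definition C4_adj : rel 'I_4 := fun i j => (j == ordS i) || (i == ordS j).

Fact C4_adj_sym : symmetric C4_adj.
Proof. by move=> i j; rewrite /C4_adj orbC. Qed.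

Fact C4_adj_irr : irreflexive C4_adj.
Proof. by case=> [[|[|[|[|i]]]] lti]. Qed.

Fact C4_gt0 : 0 < #|'I_4|.
Proof. by rewrite card_ord. Qed.

Definition C4 : sgraph := SGraph C4_adj_sym C4_adj_irr C4_gt0.

Section Connectivity.
Variable G : sgraph.
Implicit Types U W : {set G}.

Definition induced_adj W : rel G :=
  fun x y => [&& x \in W, y \in W & adj x y].

Definition disconnected W : bool :=
  [exists x in W, exists y in W, ~~ connect (induced_adj W) x y].

Definition disconnecting U : bool :=
  disconnected (~: U) || (#|~: U| == 1).

(* The default #|G| bounds the size of every [U], and removing all vertices
   but one always qualifies, so this is the minimum size of a disconnecting
   set. *)
Definition vertex_connectivity : nat :=
  \big[minn/#|G|]_(U : {set G} | disconnecting U) #|U|.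

Lemma vertex_connectivity_le U :
  disconnecting U -> vertex_connectivity <= #|U|.
Proof.
rewrite /vertex_connectivity => cutU; have := mem_index_enum U.
elim: (index_enum _) => // W r IHr; rewrite inE big_cons => /predU1P[<-|/IHr].
  by rewrite cutU geq_minl.
by case: ifP => // _; apply: leq_trans (geq_minr _ _).
Qed.

Lemma vertex_connectivity_attained :
  exists2 U, disconnecting U & #|U| = vertex_connectivity.
Proof.
have /card_gt0P[x _] := vertex_gt0 G.
have cutx : disconnecting [set~ x].
  by rewrite /disconnecting setCK cards1 eqxx orbT.
have [U cutU minU] := arg_minnP (fun U => #|U|) cutx.
exists U => //; apply/eqP; rewrite eqn_leq vertex_connectivity_le // andbT.
rewrite /vertex_connectivity.
elim/big_ind: _ => [|m n Um Un|W cutW]; first exact: max_card.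
  by rewrite leq_min Um.
exact: minU.
Qed.

End Connectivity.

Section BColoring.
Variable G : sgraph.

Definition proper_coloring k (c : {ffun G -> 'I_k}) : bool :=
  [forall x, forall y, adj x y ==> (c x != c y)].

Definition b_coloring k (c : {ffun G -> 'I_k}) : bool :=
  proper_coloring c &&
  [forall i : 'I_k, exists x : G, (c x == i) &&
     [forall j : 'I_k, (j != i) ==> [exists y : G, adj x y && (c y == j)]]].

Definition b_colorable (k : nat) : bool :=
  [exists c : {ffun G -> 'I_k}, b_coloring c].

(* The color classes of a b-coloring are nonempty, so bounding the number of
   colors by #|G| loses nothing: see [b_colorable_le]. *)
Definition b_chromatic_number : nat :=
  \max_(k < #|G|.+1 | b_colorable k) k.

Lemma b_colorable_leq_card k : b_colorable k -> k <= #|G|.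
Proof.
case/existsP=> c /andP[_ /forallP bc]; rewrite -[k]card_ord.
have [f fK] : exists f : {ffun 'I_k -> G}, cancel f c.
  have /fin_all_exists[f fP] : forall i, exists x, c x = i.
    by move=> i; have /existsP[x /andP[/eqP cx _]] := bc i; exists x.
  by exists [ffun i => f i] => i; rewrite ffunE.
exact: leq_card (can_inj fK).
Qed.

Lemma b_colorable_le k : b_colorable k -> k <= b_chromatic_number.
Proof.
move=> bk; have ltk : k < #|G|.+1 by rewrite ltnS b_colorable_leq_card.
exact: (@leq_bigmax_cond _ _ (fun i : 'I_#|G|.+1 => nat_of_ord i)
         (Ordinal ltk)).
Qed.

End BColoring.

(* The Petersen graph as the generalized Petersen graph GP(5,2): the vertices
   [(false, i)] form the outer pentagon, the vertices [(true, i)] the inner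
   pentagram, and the spokes join [(false, i)] to [(true, i)]. *)
Definition petersen_adj : rel (bool * 'I_5) := fun u v =>
  let: (a, i) := u in let: (b, j) := v in
  match a, b with
  | false, false => (j == ordS i) || (i == ordS j)
  | true, true => (j == ordS (ordS i)) || (i == ordS (ordS j))
  | _, _ => i == j
  end.

Fact petersen_adj_sym : symmetric petersen_adj.
Proof. by case=> [[] i] [[] j] /=; rewrite 1?orbC 1?eq_sym. Qed.

Fact petersen_adj_irr : irreflexive petersen_adj.
Proof. by case=> [[] [[|[|[|[|[|i]]]]] lti]]. Qed.

Fact petersen_gt0 : 0 < #|{: bool * 'I_5}|.
Proof. by rewrite card_prod card_bool card_ord. Qed.

Definition petersen : sgraph :=
  SGraph petersen_adj_sym petersen_adj_irr petersen_gt0.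

(* Main.v *)
Require Import Defs.
From mathcomp Require Import all_boot all_order all_algebra.
From mathcomp Require Import perm zify.

(** Let [U] be a minimum cut and let [A], [B] be two sides of it.  Since [G] has
    no 4-cycle and [#|U| <= (d + 1) / 2], some [x] in [A] has all its neighbours
    in [A], and at least [d / 2] of these neighbours have no neighbour in [U].
    Give the closed neighbourhood of [x] all [d + 1] colours, and then, for
    [d / 2] of the good neighbours [v] in turn, colour what is left of the
    neighbourhood of [v] with the colours still missing around [v].  Without
    4-cycles, each new vertex conflicts with at most one colour, and each colour
    with at most one new vertex, per neighbour treated before; as there are few
    of those, a conflict-free bijection exists.  So [x] and the chosen
    neighbours are b-vertices of [d / 2 + 1] prescribed colours, and the
    coloured part stays inside [A].  Doing the same in [B] for the remaining
    colours and extending greedily to [G] gives a b-coloring by [d + 1]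
    colours.  (If [U] leaves only one vertex, [G] is complete.) *)

Set Implicit Arguments.
Unset Strict Implicit.
Unset Printing Implicit Defensive.

Import Order.TTheory GRing.Theory Num.Theory.

(** * Neighbourhoods and partial colourings *)

Lemma mem_bigcup_seq (I : eqType) (T : finType) (s : seq I) (F : I -> {set T}) i z :
  i \in s -> z \in F i -> z \in \bigcup_(j <- s) F j.
Proof. by move=> si Fz; rewrite (big_rem i) //= inE Fz. Qed.

Lemma card_bigcup_seq (I : eqType) (T : finType) (s : seq I) (F : I -> {set T}) :
  {in s, forall i, #|F i| <= 1} -> #|\bigcup_(i <- s) F i| <= size s.
Proof.
elim: s => [|i s IHs] F1; first by rewrite big_nil cards0.
rewrite big_cons (leq_trans (leq_card_setU _ _)) //= -[(size s).+1]add1n leq_add //.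
  by apply: F1; rewrite mem_head.
by apply: IHs => j js; apply: F1; rewrite inE js orbT.
Qed.


(* Start from any injection; while some [z] is in conflict, counting yields [y]
   such that exchanging the values of [y] and [z] leaves neither in conflict. *)
Lemma conflict_free_injection (T K : finType) (k0 : K) (W : {set T}) (C : {set K})
    (bad : T -> K -> bool) (f : nat) :
  #|W| <= #|C| -> 2 * f <= #|W| ->
  {in W, forall z, #|[set k in C | bad z k]| <= f} ->
  {in C, forall k, #|[set z in W | bad z k]| <= f} ->
  exists h : T -> K, [/\ {in W &, injective h}, {in W, forall z, h z \in C}
    & {in W, forall z, ~~ bad z (h z)}].
Proof.
move=> leWC le2f badz badk.
suff swap n (h : T -> K) : {in W &, injective h} -> {in W, forall z, h z \in C} ->
    #|[set z in W | bad z (h z)]| < n ->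
    exists h : T -> K, [/\ {in W &, injective h}, {in W, forall z, h z \in C}
    & {in W, forall z, ~~ bad z (h z)}].
  have idx z : z \in W -> index z (enum W) < size (enum C).
    by move=> Wz; rewrite -cardE (leq_trans _ leWC) // cardE index_mem mem_enum.
  apply: (swap #|[set z in W | bad z (nth k0 (enum C) (index z (enum W)))]|.+1
     (fun z => nth k0 (enum C) (index z (enum W)))) => //.
    move=> y z Wy Wz /eqP; rewrite nth_uniq ?enum_uniq ?idx // => /eqP eqi.
    by rewrite -(nth_index y (s := enum W) (x := y)) ?mem_enum // eqi nth_index ?mem_enum.
  by move=> z Wz; rewrite -mem_enum mem_nth ?idx.
elim: n h => // n IHn h injh hC lebad.
have [/existsP[z /andP[Wz bz]]|/existsPn nob] := boolP [exists z, (z \in W) && bad z (h z)];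
  last by exists h; split=> // z Wz; have := nob z; rewrite Wz.
pose X := [set y in W | bad z (h y)]; pose Y := [set y in W | bad y (h z)].
have leX : #|X| <= f.
  rewrite -(card_in_imset (f := h)); last first.
    by move=> y y'; rewrite !inE => /andP[Wy _] /andP[Wy' _]; apply: injh.
  apply: leq_trans (badz z Wz); apply/subset_leq_card/subsetP => k.
  by case/imsetP=> y; rewrite !inE => /andP[Wy by_] ->; rewrite hC.
have leY : #|Y| <= f by apply: badk; apply: hC.
(* [X] and [Y] have at most [f] elements each and share [z], so their union has fewer than
   [2 * f <= #|W|] elements. *)
have [y Wy] : exists2 y, y \in W & y \notin X :|: Y.
  apply/subsetPn/negP => /subset_leq_card.
  have : 0 < #|X :&: Y| by apply/card_gt0P; exists z; rewrite !inE Wz bz.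
  have := cardsUI X Y; lia.
rewrite !inE Wy /= negb_or => /andP[nzy nyz].
have yz : y != z by apply: contraNneq nzy => ->.
have tW w : (tperm z y w \in W) = (w \in W).
  by case: tpermP => [->|->|]; rewrite ?Wz ?Wy.
apply: (IHn (fun w => h (tperm z y w))).
- by move=> w w' Ww Ww' /injh; rewrite !tW => /(_ Ww Ww')/perm_inj.
- by move=> w Ww; rewrite hC ?tW.
rewrite -ltnS (leq_trans _ lebad) // ltnS; apply/proper_card/properP; split.
  apply/subsetP=> w; rewrite !inE => /andP[-> /=].
  by case: tpermP => [->|->|//]; rewrite ?(negPf nzy) ?(negPf nyz).
by exists z; rewrite !inE Wz //= tpermL.
Qed.

Section Graph.
Variable G : sgraph.
Implicit Types (x y z u v : G) (A B D U : {set G}).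

Definition nbhd x : {set G} := [set y | adj x y].
Definition closed_nbhd x : {set G} := x |: nbhd x.

Lemma nbhd_sym x y : (y \in nbhd x) = (x \in nbhd y).
Proof. by rewrite !inE adj_sym. Qed.

Lemma nbhd_irr x : x \notin nbhd x.
Proof. by rewrite inE adj_irr. Qed.

(** Otherwise [x], [u], [y], [v], in this order, form a 4-cycle. *)
Lemma common_neighbor_uniq x y u v : ~ contains C4 G -> x != y ->
  u \in nbhd x -> u \in nbhd y -> v \in nbhd x -> v \in nbhd y -> u = v.
Proof.
rewrite !inE => noC4 xy xu yu xv yv; apply/eqP/negPn/negP => uv; apply: noC4.
pose f (i : C4) := nth x [:: x; u; y; v] (i : 'I_4).
have adjW (a b : G) : adj a b -> a != b.
  by apply: contraTneq => ->; rewrite adj_irr.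
have := (adjW _ _ xu, adjW _ _ yu, adjW _ _ xv, adjW _ _ yv).
case=> [[[nxu nyu] nxv] nyv].
exists f.
  move=> i j /eqP; rewrite nth_uniq ?ltn_ord //; first by move/eqP/val_inj.
  by rewrite /= !inE !negb_or nxu xy nxv uv nyv eq_sym nyu.
by case=> [[|[|[|[|i]]]] lti] [[|[|[|[|j]]]] ltj] //=; rewrite /f /= // adj_sym.
Qed.

Lemma card_common_neighbors x y : ~ contains C4 G -> x != y ->
  #|nbhd x :&: nbhd y| <= 1.
Proof.
move=> noC4 xy; apply/card_le1_eqP => u v.
rewrite !in_setI => /andP[xu yu] /andP[xv yv].
exact: (common_neighbor_uniq noC4 xy).
Qed.

Definition proper_on (K : eqType) D (c : G -> K) : Prop :=
  {in D &, forall x y, adj x y -> c x != c y}.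

Section Regular.
Variable d : nat.
Hypothesis regG : regular d G.

Lemma card_nbhd x : #|nbhd x| = d.
Proof. exact: regG. Qed.

Lemma card_closed_nbhd x : #|closed_nbhd x| = d.+1.
Proof. by rewrite cardsU1 nbhd_irr card_nbhd. Qed.

(** Uncoloured vertices are treated one by one: the [d] neighbours of a vertex use at most [d] of
    the [d.+1] colours. *)
Lemma greedy_extension D (c : G -> 'I_d.+1) : proper_on D c ->
  exists2 c' : G -> 'I_d.+1, proper_on setT c' & {in D, c' =1 c}.
Proof.
have [n] := ubnP #|~: D|; elim: n D c => // n IHn D c ltn pc.
have [DT|[z Dz]] := set_0Vmem (~: D).
  by exists c => //; rewrite -[setT](setCK) setCT -DT setCK.
have [k kP] : exists k, k \notin c @: nbhd z.
  apply/existsP; rewrite -negb_forall; apply/negP => /forallP all_k.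
  have : #|c @: nbhd z| <= d by have := leq_imset_card c (nbhd z); rewrite card_nbhd.
  rewrite (_ : c @: _ = setT) ?cardsT ?card_ord ?ltnn //.
  by apply/setP => k; rewrite all_k inE.
pose c1 y := if y == z then k else c y.
rewrite inE in Dz.
have c1D : {in D, c1 =1 c}.
  by move=> y Dy; rewrite /c1; case: eqP Dz => // <-; rewrite Dy.
have kN y : adj z y -> c y != k.
  by move=> zy; apply: contraNneq kP => <-; rewrite imset_f ?inE.
have [||c' pc' c'c1] := IHn (z |: D) c1.
- rewrite -ltnS (leq_trans _ ltn) // ltnS; apply/proper_card/properP; split.
    by rewrite setCS subsetUr.
  by exists z; rewrite !inE ?Dz ?eqxx.
- move=> x y /setU1P Dx /setU1P Dy xy; rewrite /c1.
  case: Dx xy => [->|Dx]; case: Dy => [->|Dy]; rewrite ?adj_irr ?eqxx //.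
  + by case: (y =P z) => [->|_ zy]; rewrite ?adj_irr // eq_sym; apply: kN.
  + by case: (x =P z) => [->|_ xz]; rewrite ?adj_irr //; apply: kN; rewrite adj_sym.
  + by move=> xy; rewrite -/(c1 x) -/(c1 y) !c1D // pc.
exists c' => // y Dy; rewrite c'c1 ?c1D //; exact: setU1r.
Qed.

(* In a [d]-regular graph a closed neighbourhood has [d.+1] elements, so [c] is
   injective on it exactly when it shows all colours. *)
Lemma b_colorable_of_partial D (c : G -> 'I_d.+1) : proper_on D c ->
  (forall i, exists v,
     [/\ c v = i, closed_nbhd v \subset D & {in closed_nbhd v &, injective c}]) ->
  b_colorable G d.+1.
Proof.
move=> /greedy_extension[c' pc' c'c] bc; apply/existsP; exists (finfun c').
apply/andP; split.
  apply/forallP=> x; apply/forallP=> y; apply/implyP=> xy.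
  by rewrite !ffunE pc' ?inE.
apply/forallP=> i; have [v [cv /subsetP vD injv]] := bc i.
have vv : v \in closed_nbhd v by rewrite setU11.
apply/existsP; exists v; rewrite ffunE c'c ?cv ?eqxx ?vD //=.
apply/forallP=> j; apply/implyP=> ji.
have : j \in c @: closed_nbhd v.
  rewrite (_ : c @: _ = setT) ?inE //; apply/eqP.
  by rewrite eqEcard subsetT cardsT card_ord card_in_imset // card_closed_nbhd leqnn.
case/imsetP=> y vy jE; apply/existsP; exists y; rewrite ffunE c'c ?vD // jE eqxx andbT.
by move: vy; rewrite !inE => /predU1P[yv|//]; rewrite jE yv cv eqxx in ji.
Qed.

(** A vertex that sees all other colours has at least as many neighbours as there are other
    colours. *)
Lemma b_chromatic_number_le : b_chromatic_number G <= d.+1.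
Proof.
apply/bigmax_leqP => k /existsP[c /andP[_ /forallP bc]].
case: (nat_of_ord k) c bc => [//|n] c bc; rewrite ltnS.
have /existsP[x /andP[/eqP cx /forallP xj]] := bc ord0.
rewrite -(card_nbhd x).
have <- : #|~: [set c x]| = n by rewrite cardsC1 card_ord.
apply: leq_trans (leq_imset_card c (nbhd x)).
apply/subset_leq_card/subsetP => j; rewrite !inE cx => j0.
have /existsP[y /andP[xy /eqP <-]] := implyP (xj j) j0.
by rewrite imset_f ?inE.
Qed.

Lemma b_chromatic_numberE : b_colorable G d.+1 -> b_chromatic_number G = d.+1.
Proof.
by move=> bd; apply/eqP; rewrite eqn_leq b_chromatic_number_le b_colorable_le.
Qed.

Lemma b_colorable_complete : #|G| = d.+1 -> b_colorable G d.+1.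
Proof.
move=> cardG; pose c x := cast_ord cardG (enum_rank x).
have injc : injective c by move=> x y /cast_ord_inj/enum_rank_inj.
apply: (@b_colorable_of_partial setT c).
  by move=> x y _ _; apply: contraTneq => /injc->; rewrite adj_irr.
move=> i; exists (enum_val (cast_ord (esym cardG) i)); split.
- by rewrite /c enum_valK cast_ordKV.
- exact: subsetT.
- exact: in2W.
Qed.

Hypothesis noC4 : ~ contains C4 G.

(** * Colouring the closed neighbourhoods of a vertex and of some of its neighbours *)

Section Star.
Variable x : G.
Implicit Type s : seq G.

Definition star s : {set G} :=
  [set z | (z \in closed_nbhd x) || has (fun v => z \in nbhd v) s].

Lemma in_star s z : (z \in star s) =
  (z \in closed_nbhd x) || has (fun v => z \in nbhd v) s.
Proof. by rewrite in_set. Qed.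

(** Induction on [s]: for a further leaf [v], only the part [W] of its neighbourhood outside that of
    [x] is still to be coloured, by a conflict-free injection into the set [C] of colours missing
    around [v]. *)
Lemma star_coloring (g : G -> 'I_d.+1) s :
  {in closed_nbhd x &, injective g} ->
  uniq s -> {subset s <= nbhd x} -> 2 * size s <= d ->
  exists c : G -> 'I_d.+1,
    [/\ {in closed_nbhd x, c =1 g}, proper_on (star s) c
      & {in s, forall v, {in closed_nbhd v &, injective c}}].
Proof.
move=> injg; elim: s => [|v s IHs].
  have -> : star [::] = closed_nbhd x by apply/setP=> z; rewrite in_set orbF.
  move=> _ _ _; exists g; split=> // y z xy xz.
  by apply: contraTneq => /(injg _ _ xy xz) ->; rewrite adj_irr.
rewrite [uniq _]/= => /andP[vs us] sx le_s.
have xv : v \in nbhd x by apply: sx; rewrite mem_head.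
have {}sx : {subset s <= nbhd x} by move=> i si; apply: sx; rewrite inE si orbT.
rewrite [size _]/= in le_s.
have [//|//||c [cg pc injc]] := IHs; first by lia.
set Nx := closed_nbhd x; set Nv := closed_nbhd v.
have Nxx : x \in Nx by rewrite setU11.
have Nxv : v \in Nx by rewrite setU1r.
have sNx i : i \in s -> i \in Nx by move=> si; rewrite setU1r ?sx.
have cinj : {in Nx &, injective c}.
  by move=> y z xy xz; rewrite !cg //; apply: injg.
pose W := Nv :\: Nx; pose C := ~: (c @: (Nv :&: Nx)).
have cardI : #|c @: (Nv :&: Nx)| = #|Nv :&: Nx|.
  by apply: card_in_imset => y z /setIP[_ xy] /setIP[_ xz]; apply: cinj.
have cardWI : #|Nv :&: Nx| + #|W| = d.+1 by rewrite cardsID card_closed_nbhd.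
have cardWC : #|W| <= #|C|.
  have := cardsC (c @: (Nv :&: Nx)); rewrite card_ord cardI -/C; lia.
(* The intersection consists of [x], [v] and at most one common neighbour. Hence
   [#|W| >= d - 2 >= 2 * size s], the room that [conflict_free_injection] asks for. *)
have leI : #|Nv :&: Nx| <= 3.
  have xDv : x != v by apply: contraTneq xv => ->; apply: nbhd_irr.
  have le1 := card_common_neighbors noC4 xDv.
  apply: leq_trans (_ : #|[set x; v] :|: (nbhd x :&: nbhd v)| <= 3).
    apply/subset_leq_card/subsetP => y; rewrite !inE.
    by do 2!case: eqP => //=; move=> _ _ /andP[-> ->].
  rewrite (leq_trans (leq_card_setU _ _)) // (@leq_add _ _ 2 1) //.
  by rewrite cards2; case: (_ != _).
have WNv z : z \in W -> z \in nbhd v.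
  by case/setDP=> /setU1P[->|//]; rewrite Nxv.
have WNx z : z \in W -> z \notin Nx by case/setDP.
have Wuniq z w : z \in W -> w \in nbhd x -> z \in nbhd w -> w = v.
  move=> Wz xw wz; apply: (common_neighbor_uniq noC4 (x := x) (y := z)) => //.
  - by apply: contraNneq (WNx z Wz) => <-.
  - by rewrite nbhd_sym.
  - by rewrite nbhd_sym WNv.
(* Inside [Nx], a vertex of [W] is adjacent to [v] alone, whose colour is not in [C]. So conflicts
   arise only from vertices outside [Nx] that are adjacent to earlier leaves. *)
pose F i : {set G} := nbhd i :\: Nx.
pose bad z k := has (fun i => [exists w in F i, (w \in nbhd z) && (c w == k)]) s.
have [|||h [injh hC hbad]] := @conflict_free_injection _ _ ord0 W C bad (size s) cardWC.
- lia.
(* For each earlier leaf [i], the vertices [z] and [i] have at most one common neighbour, which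
   forbids at most one colour at [z]. *)
- move=> z Wz; apply: leq_trans (_ : #|\bigcup_(i <- s) (nbhd z :&: nbhd i)| <= _).
    apply: leq_trans (leq_imset_card c _); apply/subset_leq_card/subsetP => k.
    rewrite inE => /andP[_ /hasP[i si /exists_inP[w /setDP[iw _] /andP[zw /eqP <-]]]].
    by apply: imset_f; apply: (mem_bigcup_seq si); rewrite in_setI zw.
  apply: card_bigcup_seq => i si; apply: card_common_neighbors => //.
  by apply: contraNneq (WNx z Wz) => ->; apply: sNx.
(* Since [c] is injective around the leaf [i], a single neighbour [w] of [i] has colour [k]. A
   vertex of [W] in conflict through [w] is a common neighbour of [v] and [w], hence unique. *)
- move=> k _; pose E i := [set z in W | [exists w in F i, (w \in nbhd z) && (c w == k)]].
  apply: leq_trans (_ : #|\bigcup_(i <- s) E i| <= _).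
    apply/subset_leq_card/subsetP => z.
    rewrite inE => /andP[Wz /hasP[i si zi]].
    by apply: (mem_bigcup_seq si); rewrite in_set Wz.
  apply: card_bigcup_seq => i si; apply/card_le1_eqP => z z'.
  rewrite /E in_set [z' \in _]in_set => /andP[Wz /exists_inP[w /setDP[iw xw] /andP[zw /eqP cw]]].
  case/andP=> Wz' /exists_inP[w' /setDP[iw' _] /andP[zw' /eqP cw']].
  have ww' : w = w' by apply: (injc i si); rewrite ?setU1r // cw cw'.
  have vw : v != w by apply: contraNneq xw => <-.
  by apply: (common_neighbor_uniq noC4 vw); rewrite ?WNv // nbhd_sym // ww'.
pose c' z := if z \in W then h z else c z.
have c'W z : z \in W -> c' z = h z by rewrite /c' => ->.
have c'x z : z \in Nx -> c' z = c z.
  by move=> xz; rewrite /c' ifN //; apply: contraL xz => /WNx.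
have NxD z : z \in Nx -> z \in star s by rewrite in_star => ->.
have NiD i z : i \in s -> z \in nbhd i -> z \in star s.
  by move=> si iz; rewrite in_star; apply/orP; right; apply/hasP; exists i.
(* No vertex of [W] was coloured before: by [Wuniq], one adjacent to an earlier leaf would force
   that leaf to be [v]. *)
have c'D z : z \in star s -> c' z = c z.
  rewrite in_star => /orP[/c'x//|/hasP[i si iz]]; rewrite /c'; case: ifP => // Wz.
  by rewrite -(Wuniq _ _ Wz (sx i si) iz) si in vs.
have cross z w : z \in W -> w \in star s -> adj z w -> h z != c w.
  move=> Wz; rewrite in_star -/Nx => Dw zw.
  have [xw|xw] := boolP (w \in Nx).
    have wv : w = v.
      move: xw; rewrite /Nx !inE => /predU1P[wx|xw].
        by have := WNx z Wz; rewrite setU1r // inE adj_sym -wx.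
      by apply: (Wuniq z) => //; rewrite inE // adj_sym.
    apply: contraTneq (hC z Wz) => ->; rewrite inE negbK imset_f //.
    by rewrite wv inE Nxv setU11.
  move: Dw; rewrite (negPf xw) /= => /hasP[i si iw].
  apply: contra (hbad z Wz) => /eqP hz; apply/hasP; exists i => //.
  by apply/exists_inP; exists w; [rewrite /F in_setD xw | rewrite hz eqxx inE zw].
have starW z : z \in star (v :: s) -> z \in W \/ z \in star s.
  rewrite [z \in star (v :: s)]in_star /= => /or3P[xz|vz|sz].
  - by right; apply: NxD.
  - have [zx|zx] := boolP (z \in Nx); first by right; apply: NxD.
    by left; rewrite in_setD zx setU1r.
  - by right; rewrite in_star sz orbT.
exists c'; split.
- by move=> z xz; rewrite c'x ?cg.
- move=> y z /starW Dy /starW Dz yz.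
  case: Dy => [Wy|Dy]; case: Dz => [Wz|Dz].
  + by rewrite !c'W //; apply: contraTneq yz => /(injh _ _ Wy Wz) ->; rewrite adj_irr.
  + by rewrite c'W // c'D // cross.
  + by rewrite c'D // c'W // eq_sym cross // adj_sym.
  + by rewrite !c'D // pc.
- move=> i; rewrite inE => /predU1P[->|si].
    have NvI z : z \in closed_nbhd v -> z \notin W -> z \in Nv :&: Nx.
      by rewrite in_setD in_setI -/Nv => ->; rewrite andbT negbK.
    move=> y z vy vz; have [Wy|/(NvI _ vy)Iy] := boolP (y \in W);
      have [Wz|/(NvI _ vz)Iz] := boolP (z \in W).
    + by rewrite !c'W //; apply: injh.
    + have /setIP[_ xz] := Iz; rewrite c'W // (c'x z) // => hy.
      by have := hC y Wy; rewrite hy inE imset_f.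
    + have /setIP[_ xy] := Iy; rewrite (c'x y) // c'W // => hy.
      by have := hC z Wz; rewrite -hy inE imset_f.
    + by have /setIP[_ xy] := Iy; have /setIP[_ xz] := Iz; rewrite !c'x //; apply: cinj.
  have iD z : z \in closed_nbhd i -> z \in star s.
    by case/setU1P=> [->|iz]; [apply/NxD/sNx | apply: NiD iz].
  by move=> y z iy iz; rewrite (c'D y (iD y iy)) (c'D z (iD z iz)); apply: (injc i si).
Qed.
End Star.
End Regular.
End Graph.

(** * The two sides of a cut *)

Section Sides.
Variables (G : sgraph) (d : nat).
Hypotheses (regG : regular d G) (noC4 : ~ contains C4 G).
Implicit Types (x y z u v a b : G) (A B D U : {set G}).

Lemma nbhd_neq x y : x \in nbhd y -> x != y.
Proof. by apply: contraTneq => ->; apply: nbhd_irr. Qed.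

(** * Finding a centre away from the cut and colouring one side *)

Section Center.
Variables A U : {set G}.
Hypotheses (AU0 : [disjoint A & U]) (nbhdA : {in A, forall a, nbhd a \subset A :|: U}).
Hypothesis leU : 2 * #|U| <= d.+1.

Let neqAU a u : a \in A -> u \in U -> a != u.
Proof. by move=> Aa; apply: contraTneq => <-; rewrite (disjointFr AU0). Qed.

Lemma card_nbhd_side a : a \in A -> #|nbhd a :&: A| + #|nbhd a :&: U| = d.
Proof.
move=> Aa; rewrite -(card_nbhd regG a) -(cardsID A (nbhd a)); congr (_ + _).
apply: eq_card => z; rewrite !in_setI in_setD.
have [az|] := boolP (z \in nbhd a); rewrite ?andbF // andbT /=.
have /setUP[Az|Uz] := subsetP (nbhdA Aa) z az.
  by rewrite Az (disjointFr AU0 Az).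
by rewrite Uz (disjointFl AU0 Uz).
Qed.

(** Double counting of the paths [a - b - u]: each [u] in [U] shares at most one neighbour with
    [a]. *)
Lemma sum_card_nbhd_le a : a \in A ->
  \sum_(b in nbhd a :&: A) #|nbhd b :&: U| <= #|U|.
Proof.
move=> Aa.
have -> : \sum_(b in nbhd a :&: A) #|nbhd b :&: U| =
          \sum_(u in U) #|(nbhd a :&: A) :&: nbhd u|.
  under eq_bigr do rewrite -sum1_card.
  under [RHS]eq_bigr do rewrite -sum1_card.
  rewrite (exchange_big_dep (mem U)) /=; last by move=> b u _ /setIP[].
  apply: eq_bigr => u Uu; apply: eq_bigl => b.
  by rewrite [in RHS]in_setI [u \in _]in_setI Uu andbT nbhd_sym.
rewrite -sum1_card; apply: leq_sum => u Uu.
apply: leq_trans (card_common_neighbors noC4 (neqAU Aa Uu)).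
by apply/subset_leq_card/setSI/subsetIl.
Qed.

Hypothesis exitU : {in U, forall u, exists2 z, z \in nbhd u & z \notin A}.

Let card_nbhdU u : u \in U -> #|nbhd u :&: A| < d.
Proof.
move=> Uu; have [z uz Az] := exitU Uu.
rewrite -(card_nbhd regG u); apply/proper_card/properP; split; first exact: subsetIl.
by exists z; rewrite // in_setI uz.
Qed.

(** * The exceptional case of a cubic graph with two cut vertices *)

Section Cubic.
Variables (u1 u2 : G).
Hypotheses (U12 : U = [set u1; u2]) (u12 : u1 != u2) (d3 : d = 3).
Hypothesis A_adjU : {in A, forall a, 0 < #|nbhd a :&: U|}.

Let Uadj a u u' : U = [set u; u'] -> a \in A -> u \notin nbhd a -> u' \in nbhd a.
Proof.
move=> UE Aa; have /card_gt0P[w /setIP[aw]] := A_adjU Aa.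
by rewrite UE => /set2P[<-|<-]; rewrite aw.
Qed.

(** The two neighbours [p], [q] of [a] in [A] cannot share a vertex of [U], as [a] is already their
    common neighbour. Each of them sees [U], so one sees only [u] and the other only [u']. *)
Lemma cubic_private_neighbors u u' a : U = [set u; u'] -> u != u' -> a \in A ->
  u \in nbhd a -> u' \notin nbhd a ->
  (exists2 b, b \in nbhd a :&: A & (u \in nbhd b) && (u' \notin nbhd b)) /\
  (exists2 b, b \in nbhd a :&: A & (u' \in nbhd b) && (u \notin nbhd b)).
Proof.
move=> UE uu' Aa au au'.
have cardU : #|nbhd a :&: U| = 1.
  rewrite (_ : _ :&: _ = [set u]) ?cards1 //; apply/setP=> w.
  rewrite UE in_setI !inE; have [->|_] := eqVneq w u; first by rewrite inE in au; rewrite au.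
  by apply/andP => -[aw /eqP wu']; rewrite inE -wu' aw in au'.
have /eqP/cards2P[p [q [pq pqE]]] : #|nbhd a :&: A| = 2 by have := card_nbhd_side Aa; lia.
have /setIP[ap Ap] : p \in nbhd a :&: A by rewrite pqE set21.
have /setIP[aq Aq] : q \in nbhd a :&: A by rewrite pqE set22.
have Uu : u \in U by rewrite UE set21.
have Uu' : u' \in U by rewrite UE set22.
have not_both w : w \in U -> w \in nbhd p -> w \in nbhd q -> False.
  move=> Uw pw qw; case/eqP: pq.
  by apply: (common_neighbor_uniq noC4 (neqAU Aa Uw)) => //; rewrite nbhd_sym.
have UE' : U = [set u'; u] by rewrite UE setUC.
have [pu|pu] := boolP (u \in nbhd p).
  have qu : u \notin nbhd q by apply/negP; apply: not_both.
  have qu' := Uadj UE Aq qu.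
  have pu' : u' \notin nbhd p by apply/negP => pu'; apply: (not_both u').
  split; [exists p | exists q]; try (by rewrite in_setI ?ap ?aq).
    by rewrite pu.
  by rewrite qu'.
have pu' := Uadj UE Ap pu.
have qu' : u' \notin nbhd q by apply/negP; apply: not_both.
have qu := Uadj UE' Aq qu'.
split; [exists q | exists p]; try (by rewrite in_setI ?ap ?aq).
  by rewrite qu.
by rewrite pu'.
Qed.

(** Applying [cubic_private_neighbors] to [a], and then to the neighbours [a'] and [b] it provides,
    yields [b'] next to [a'] and [c] next to [b], where [b], [b'], [c] all see [u']. As [u'] has at
    most two neighbours in [A], [c = b'], and [a], [a'], [b'], [b] close a 4-cycle. *)
Lemma cubic_no_private u u' a : U = [set u; u'] -> u != u' -> a \in A ->
  u \in nbhd a -> u' \in nbhd a.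
Proof.
move=> UE uu' Aa au; apply/negPn/negP => au'.
have UE' : U = [set u'; u] by rewrite UE setUC.
have Uu : u \in U by rewrite UE set21.
have Uu' : u' \in U by rewrite UE set22.
have [] := cubic_private_neighbors UE uu' Aa au au'.
case=> a' /setIP[aa' Aa'] /andP[a'u a'u'] [b /setIP[ab Ab] /andP[bu' bu]].
have [_ [b' /setIP[a'b' Ab'] /andP[b'u' b'u]]] := cubic_private_neighbors UE uu' Aa' a'u a'u'.
have [|[c /setIP[bc Ac] /andP[cu' cu]] _] := cubic_private_neighbors UE' _ Ab bu' bu.
  by rewrite eq_sym.
have bb' : b != b'.
  apply: contraTneq aa' => bb'; rewrite -bb' in a'b'.
  suff -> : a = a' by rewrite nbhd_irr.
  by apply: (common_neighbor_uniq noC4 (neqAU Ab Uu)); rewrite nbhd_sym.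
have cb' : c = b'.
  apply/eqP/negPn/negP => cb'.
  have := card_nbhdU Uu'; rewrite d3 ltnNge => /negP[].
  have <- : #|[set b; b'; c]| = 3.
    by rewrite setUC cardsU1 cards2 !inE negb_or (nbhd_neq bc) cb' bb'.
  apply/subset_leq_card/subsetP=> w; rewrite in_setU in_setI nbhd_sym => /orP[/set2P[]|/set1P]->.
  - by rewrite bu'.
  - by rewrite b'u'.
  - by rewrite cu'.
have ab' : a != b' by apply: contraNneq au' => ->.
have a'b : a' = b.
  apply: (common_neighbor_uniq noC4 ab' aa' _ ab); first by rewrite nbhd_sym.
  by rewrite -cb' nbhd_sym.
by rewrite a'b bu' in a'u'.
Qed.

(** Every vertex of [A] would see both [u1] and [u2], so two adjacent vertices of [A] would have two
    common neighbours. *)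
Lemma cubic_side_empty : A = set0.
Proof.
have [//|[a Aa]] := set_0Vmem A.
have UE' : U = [set u2; u1] by rewrite U12 setUC.
have u21 : u2 != u1 by rewrite eq_sym.
have all_adj b : b \in A -> (u1 \in nbhd b) && (u2 \in nbhd b).
  move=> Ab; have [bu1|bu1] := boolP (u1 \in nbhd b).
    by rewrite (cubic_no_private U12 u12 Ab).
  have bu2 := Uadj U12 Ab bu1.
  by rewrite (cubic_no_private UE' u21 Ab bu2) in bu1.
have : 0 < #|nbhd a :&: A|.
  have := card_nbhd_side Aa; have := subset_leq_card (subsetIr (nbhd a) U).
  rewrite {2}U12 cards2 u12 d3; lia.
case/card_gt0P=> b /setIP[ab Ab].
have /andP[au1 au2] := all_adj a Aa; have /andP[bu1 bu2] := all_adj b Ab.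
case/eqP: u12; apply: (common_neighbor_uniq noC4 (x := a) (y := b)) => //.
by rewrite eq_sym nbhd_neq.
Qed.
End Cubic.

(* If every vertex of [A] had a neighbour in [U], counting the paths [a - b - u]
   with [b] in [A] and [u] in [U] would give [(d - #|U|)^2 <= #|U|], which leaves
   only [d = #|U| = 1], [d = #|U|.+1 = 2] and [d = #|U|.+1 = 3]. *)
Lemma exists_center : A != set0 -> exists2 x, x \in A & nbhd x \subset A.
Proof.
move=> A0; apply/exists_inP; apply: contraT => /exists_inPn noA.
have A_adjU a : a \in A -> 0 < #|nbhd a :&: U|.
  move=> Aa; have /subsetPn[z az Az] := noA a Aa; apply/card_gt0P; exists z.
  by have := subsetP (nbhdA Aa) z az; rewrite in_setU (negPf Az) in_setI az.
have leA a : a \in A -> #|nbhd a :&: A| <= #|U|.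
  move=> Aa; apply: leq_trans (sum_card_nbhd_le Aa).
  by rewrite -sum1_card leq_sum // => b /setIP[_ /A_adjU].
have /set0Pn[a Aa] := A0.
have geU b : b \in A -> d - #|U| <= #|nbhd b :&: U|.
  by move=> Ab; have := leA b Ab; have := card_nbhd_side Ab; lia.
have leU2 b : #|nbhd b :&: U| <= #|U| by apply/subset_leq_card/subsetIr.
have : (d - #|U|) * (d - #|U|) <= #|U|.
  apply: leq_trans (sum_card_nbhd_le Aa).
  apply: leq_trans (_ : #|nbhd a :&: A| * (d - #|U|) <= _).
    rewrite leq_mul2r; apply/orP; right.
    by have := card_nbhd_side Aa; have := leU2 a; lia.
  by rewrite -sum_nat_const leq_sum // => b /setIP[_ /geU].
have U0 := leq_trans (A_adjU a Aa) (leU2 a).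
have /card_gt0P[u /setIP[au Uu]] := A_adjU a Aa.
have ltu := card_nbhdU Uu.
have gtu : 0 < #|nbhd u :&: A| by apply/card_gt0P; exists a; rewrite in_setI nbhd_sym au.
move=> le2.
(* Here [gtu] and [ltu] give [d >= 2], which rules out [d = #|U| = 1]. *)
have [[dE UE]|[dE UE]] : d = 2 /\ #|U| = 1 \/ d = 3 /\ #|U| = 2 by nia.
  (* For [d = 2], both [a] and its neighbour [b] in [A] see the only cut vertex [u], which then has
     no neighbour outside [A]. *)
  have /card_gt0P[b /setIP[ab Ab]] : 0 < #|nbhd a :&: A|.
    by have := card_nbhd_side Aa; have := leU2 a; lia.
  have /card_gt0P[u' /setIP[bu' Uu']] := A_adjU b Ab.
  have /card_le1_eqP eqU : #|U| <= 1 by rewrite UE.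
  have uu' : u = u' by apply: eqU.
  have : #|[set a; b]| <= #|nbhd u :&: A|.
    apply/subset_leq_card/subsetP => w /set2P[]->; rewrite in_setI.
      by rewrite nbhd_sym au.
    by rewrite nbhd_sym uu' bu'.
  by rewrite cards2 eq_sym (nbhd_neq ab) /=; lia.
have /eqP/cards2P[u1 [u2 [u12 U12]]] := UE.
by rewrite (cubic_side_empty U12 u12 dE A_adjU) eqxx in A0.
Qed.

(** Each [u] in [U] spoils at most one neighbour of [x], namely their common neighbour, so at least
    [d - #|U| >= d./2] neighbours remain. *)
Lemma exists_leaves x : x \in A -> nbhd x \subset A ->
  exists s, [/\ uniq s, {subset s <= nbhd x}, size s = d./2 & star x s \subset A].
Proof.
move=> Ax xA; pose L := [set v in nbhd x | [disjoint nbhd v & U]].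
have leL : #|nbhd x :\: L| <= #|U|.
  rewrite [#|U|]cardE.
  apply: leq_trans (_ : #|\bigcup_(u <- enum U) (nbhd x :&: nbhd u)| <= _).
    apply/subset_leq_card/subsetP => v /setDP[xv]; rewrite in_set xv /=.
    case/pred0Pn=> u /andP[/= vu Uu].
    by apply: (@mem_bigcup_seq _ _ _ _ u); rewrite ?mem_enum // in_setI xv nbhd_sym.
  apply: card_bigcup_seq => u; rewrite mem_enum => Uu.
  by apply: card_common_neighbors => //; apply: neqAU.
have LE : nbhd x :&: L = L by apply/setIidPr/subsetP => v; rewrite in_set => /andP[].
have geL : d./2 <= #|L|.
  have := cardsID L (nbhd x); rewrite LE (card_nbhd regG); lia.
have sub : {subset take d./2 (enum L) <= L}.
  by move=> v /mem_take; rewrite mem_enum.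
exists (take d./2 (enum L)); split.
- by rewrite take_uniq ?enum_uniq.
- by move=> v /sub; rewrite in_set => /andP[].
- by rewrite size_takel // -cardE.
apply/subsetP=> z; rewrite in_star => /orP[/setU1P[->//|/(subsetP xA)//]|].
case/hasP=> v /sub; rewrite in_set => /andP[/(subsetP xA)Av dv] vz.
by have /setUP[//|Uz] := subsetP (nbhdA Av) z vz; rewrite (disjointFr dv vz) in Uz.
Qed.

Lemma side_coloring : A != set0 ->
  exists D (c : G -> 'I_d.+1), [/\ D \subset A, proper_on D c &
    forall i : 'I_d.+1, i <= d./2 -> exists v,
      [/\ c v = i, closed_nbhd v \subset D & {in closed_nbhd v &, injective c}]].
Proof.
move=> /exists_center[x Ax xA]; have [s [us sx size_s sA]] := exists_leaves Ax xA.
(* Colouring by position in [t], with the centre and the leaves in front, makes them the b-vertices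
   of the colours [0] to [d./2]. *)
pose t := (x :: s) ++ [seq z <- enum (nbhd x) | z \notin s].
have xs : x \notin s by apply: contra (nbhd_irr x); apply: sx.
have tE : t =i closed_nbhd x.
  move=> z; rewrite mem_cat in_setU1 in_cons mem_filter mem_enum.
  by case: eqP => //= _; case sz: (z \in s) => //=; rewrite sx.
have ut : uniq t.
  rewrite cat_uniq /= xs us filter_uniq ?enum_uniq //= andbT.
  apply/hasPn => z; rewrite mem_filter mem_enum in_cons negb_or => /andP[-> xz].
  by rewrite nbhd_neq.
have size_t : size t = d.+1.
  by rewrite -(card_uniqP ut) (eq_card tE) (card_closed_nbhd regG).
have lt_t z : z \in closed_nbhd x -> index z t < d.+1.
  by rewrite -tE -size_t index_mem.
pose g z : 'I_d.+1 := inord (index z t).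
have injg : {in closed_nbhd x &, injective g}.
  move=> y z xy xz /(congr1 val); rewrite /= !inordK ?lt_t // => eqi.
  by rewrite -(nth_index x (s := t) (x := y)) ?tE // eqi nth_index ?tE.
have [|c [cg pc injc]] := star_coloring regG noC4 injg us sx; first by rewrite size_s; lia.
exists (star x s), c; split=> // i lei; pose v := nth x t i.
have ltis : i < size (x :: s) by rewrite /= size_s.
have vxs : v \in x :: s by rewrite /v nth_cat ltis mem_nth.
have xv : v \in closed_nbhd x by rewrite -tE mem_cat vxs.
exists v; split.
- by rewrite cg // /g /v index_uniq ?size_t ?inord_val.
- apply/subsetP=> z vz; rewrite in_star.
  have [->|nzv] := eqVneq z v; first by rewrite xv.
  have {}vz : z \in nbhd v by case/setU1P: vz nzv => [->|//]; rewrite eqxx.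
  case/predU1P: vxs => [vx|sv]; first by rewrite setU1r // -vx.
  by apply/orP; right; apply/hasP; exists v.
case/predU1P: vxs => [->|sv]; last exact: injc.
by move=> y z xy xz; rewrite !cg //; apply: injg.
Qed.
End Center.

Lemma b_colorable_of_separation A B U :
  [disjoint A & U] -> [disjoint B & U] -> [disjoint A & B] ->
  A != set0 -> B != set0 -> 2 * #|U| <= d.+1 ->
  {in A, forall a, nbhd a \subset A :|: U} ->
  {in B, forall b, nbhd b \subset B :|: U} ->
  {in U, forall u, exists2 z, z \in nbhd u & z \notin A} ->
  {in U, forall u, exists2 z, z \in nbhd u & z \notin B} ->
  b_colorable G d.+1.
Proof.
move=> AU BU AB A0 B0 leU nA nB xA xB.
have [D [c [DA pc bc]]] := side_coloring AU nA leU xA A0.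
have [E [e [EB pe be]]] := side_coloring BU nB leU xB B0.
(* Reversing the colours on [B] turns its b-vertices into those of the colours from [d - d./2] to
   [d]. Together with the colours up to [d./2] obtained in [A], all are covered. *)
pose f z := if z \in A then c z else rev_ord (e z).
have fD z : z \in D -> f z = c z by move/(subsetP DA); rewrite /f => ->.
have fE z : z \in E -> f z = rev_ord (e z).
  by move/(subsetP EB) => Bz; rewrite /f (disjointFl AB Bz).
have noDE y z : y \in D -> z \in E -> ~~ adj y z.
  move=> /(subsetP DA)Ay /(subsetP EB)Bz; apply/negP => yz.
  have /setUP[Az|Uz] : z \in A :|: U by apply: (subsetP (nA y Ay)); rewrite inE.
    by rewrite (disjointFr AB Az) in Bz.
  by rewrite (disjointFr BU Bz) in Uz.
apply: (b_colorable_of_partial regG (D := D :|: E) (c := f)).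
  move=> y z /setUP[Dy|Ey] /setUP[Dz|Ez] yz.
  - by rewrite !fD // pc.
  - by rewrite (negPf (noDE y z Dy Ez)) in yz.
  - by rewrite adj_sym (negPf (noDE z y Dz Ey)) in yz.
  - by rewrite !fE // (inj_eq rev_ord_inj) pe.
move=> i; have [lei|gti] := leqP i d./2.
  have [v [cv vD injv]] := bc i lei; exists v; have vv := subsetP vD.
  split; first by rewrite fD ?vv ?setU11.
    exact: subset_trans vD (subsetUl _ _).
  by move=> y z vy vz; rewrite !fD ?vv //; apply: injv.
have [|v [ev vE injv]] := be (rev_ord i).
  by rewrite /= subSS; have := ltn_ord i; lia.
exists v; have vv := subsetP vE.
split; first by rewrite fE ?vv ?setU11 // ev rev_ordK.
  exact: subset_trans vE (subsetUr _ _).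
by move=> y z vy vz; rewrite !fE ?vv // => /rev_ord_inj; apply: injv.
Qed.

End Sides.

(** * From a minimum cut to a separation *)

Section Cut.
Variable G : sgraph.
Implicit Types (x y z u : G) (A B S U W : {set G}).

Lemma induced_adj_sym W : symmetric (induced_adj W).
Proof. by move=> x y; rewrite /induced_adj adj_sym andbCA. Qed.

Lemma disconnected_of_closed W S x y :
  {in S, forall z, nbhd z :&: W \subset S} ->
  x \in W :&: S -> y \in W :\: S -> disconnected W.
Proof.
move=> clS /setIP[Wx Sx] /setDP[Wy Sy].
apply/exists_inP; exists x => //; apply/exists_inP; exists y => //.
apply: contra Sy => xy; rewrite -(closed_connect _ xy) //.
apply: intro_closed; first exact/sym_connect_sym/induced_adj_sym.
move=> w z /and3P[_ Wz wz] Sw; apply: (subsetP (clS w Sw)).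
by rewrite in_setI inE wz.
Qed.

(** If all neighbours of [u] were in [A], then [u] could join [A], and [U :\ u] would be a smaller
    cut. *)
Lemma minimal_cut_exit A B U :
  #|U| = vertex_connectivity G ->
  [disjoint A & U] -> [disjoint B & U] -> [disjoint A & B] ->
  A != set0 -> B != set0 -> {in A, forall a, nbhd a \subset A :|: U} ->
  {in U, forall u, exists2 z, z \in nbhd u & z \notin A}.
Proof.
move=> cardU AU BU AB /set0Pn[a Aa] /set0Pn[b Bb] nA u Uu.
apply/subsetPn/negP => uA.
have : vertex_connectivity G <= #|U :\ u|.
  apply: vertex_connectivity_le; apply/orP; left.
  apply: (@disconnected_of_closed _ (u |: A) a b).
  - move=> w /setU1P wA; apply/subsetP => z /setIP[wz].
    rewrite in_setC in_setD1 negb_and negbK in_setU1 => uz.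
    case: wA => [wu|Aw]; first by rewrite (subsetP uA) ?orbT // -wu.
    case/orP: uz => [->//|zU]; have := subsetP (nA w Aw) z wz.
    by rewrite in_setU (negPf zU) orbF => ->; rewrite orbT.
  - by rewrite in_setI in_setC in_setD1 (disjointFr AU Aa) andbF setU1r.
  - rewrite in_setD in_setC in_setD1 (disjointFr BU Bb) andbF in_setU1 negb_or.
    rewrite (disjointFl AB Bb) !andbT.
    by apply: contraTneq Uu => <-; rewrite (disjointFr BU Bb).
by rewrite -cardU [#|U|](cardsD1 u) Uu ltnn.
Qed.

Lemma b_colorable_of_connectivity d : regular d G -> ~ contains C4 G ->
  2 * vertex_connectivity G <= d.+1 -> b_colorable G d.+1.
Proof.
move=> regG noC4 leG; have [U /orP[dU|cardCU] cardU] := vertex_connectivity_attained G.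
  case/exists_inP: dU => x Ux /exists_inP[y Uy xy].
  (* [A] is the component of [x] outside [U]; [B], defined below as the rest, may consist of several
     components. *)
  pose e := induced_adj (~: U); pose A := [set z | connect e x z].
  have csym : connect_sym e by apply/sym_connect_sym/induced_adj_sym.
  have AU : [disjoint A & U].
    apply/pred0P => z /=; rewrite in_set; apply/andP => -[xz Uz].
    have clU : closed e (~: U) by move=> w w' /and3P[-> ->].
    by have := closed_connect clU xz; rewrite Ux in_setC Uz.
  have nA : {in A, forall a, nbhd a \subset A :|: U}.
    move=> a Aa; apply/subsetP => z az; rewrite in_setU.
    have [_|Uz] := boolP (z \in U); rewrite ?orbT // orbF in_set.
    have xa : connect e x a by rewrite in_set in Aa.
    apply: connect_trans xa (connect1 _); rewrite inE in az.
    by rewrite /e /induced_adj az !in_setC Uz (disjointFr AU Aa).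
  pose B := ~: U :\: A.
  have AB : [disjoint A & B].
    by apply/pred0P => z /=; rewrite in_setD; case: (z \in A).
  have BU : [disjoint B & U].
    by apply/pred0P => z /=; rewrite in_setD in_setC; case: (z \in U); rewrite andbF.
  have nB : {in B, forall b, nbhd b \subset B :|: U}.
    move=> b Bb; apply/subsetP => z bz; rewrite in_setU in_setD in_setC.
    have [_|Uz] := boolP (z \in U); rewrite ?orbT // orbF andbT.
    apply/negP => Az; have := subsetP (nA z Az) b.
    rewrite nbhd_sym bz => /(_ isT); rewrite in_setU.
    by rewrite (disjointFl AB Bb) (disjointFr BU Bb).
  have A0 : A != set0 by apply/set0Pn; exists x; rewrite in_set.
  have B0 : B != set0 by apply/set0Pn; exists y; rewrite in_setD Uy in_set xy.
  have BA : [disjoint B & A] by rewrite disjoint_sym.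
  apply: (b_colorable_of_separation regG noC4 AU BU AB) => //.
  - by rewrite cardU.
  - exact: minimal_cut_exit AU BU AB A0 B0 nA.
  - exact: minimal_cut_exit BU AU BA B0 A0 nB.
(* Here [#|U| = #|G| - 1] and [d.+1 <= #|G|], so [2 * (#|G| - 1) <= d.+1 <= #|G|]. This leaves one
   vertex with [d = 0] or two with [d = 1]. *)
apply: b_colorable_complete => //.
have := cardsC U; rewrite (eqP cardCU) => cardG.
have /card_gt0P[x _] := vertex_gt0 G.
have := max_card (closed_nbhd x); rewrite (card_closed_nbhd regG) => ledG.
lia.
Qed.
End Cut.

(** Positivity excludes the default value [0] of the maximum. *)
Lemma b_chromatic_number_attained (G : sgraph) :
  0 < b_chromatic_number G -> b_colorable G (b_chromatic_number G).
Proof.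
rewrite /b_chromatic_number; elim/big_ind: _ => // m n Pm Pn.
by rewrite /maxn; case: ifP.
Qed.

Lemma b_coloring_perm (G : sgraph) k (c : {ffun G -> 'I_k}) (s : {perm 'I_k}) :
  b_coloring c -> b_coloring [ffun x => s (c x)].
Proof.
case/andP=> /forallP pc /forallP bc; apply/andP; split.
  apply/forallP=> x; apply/forallP=> y; rewrite !ffunE (inj_eq perm_inj).
  exact: (forallP (pc x)).
apply/forallP=> i; have /existsP[x /andP[/eqP cx /forallP xj]] := bc (s^-1%g i).
apply/existsP; exists x; rewrite ffunE cx permKV eqxx /=.
apply/forallP=> j; apply/implyP=> ji.
have ji' : s^-1%g j != s^-1%g i by rewrite (inj_eq perm_inj).
have /existsP[y /andP[xy /eqP cy]] := implyP (xj _) ji'.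
by apply/existsP; exists y; rewrite xy ffunE cy permKV eqxx.
Qed.

(** * The Petersen graph *)

Definition petersen_vertices : seq petersen :=
  [seq (a, i) | a <- [:: false; true],
     i <- [:: @Ordinal 5 0 isT; @Ordinal 5 1 isT; @Ordinal 5 2 isT;
              @Ordinal 5 3 isT; @Ordinal 5 4 isT]].

Lemma mem_petersen_vertices v : v \in petersen_vertices.
Proof. by case: v => [[] [[|[|[|[|[|i]]]]] lti]]. Qed.

Lemma card_petersen_pred (P : pred petersen) :
  #|[set v | P v]| = count P petersen_vertices.
Proof.
rewrite -size_filter -(card_uniqP _) ?filter_uniq //.
by apply: eq_card => v; rewrite inE mem_filter mem_petersen_vertices andbT.
Qed.

Lemma petersen_regular : regular 3 petersen.
Proof.
move=> x; rewrite card_petersen_pred; apply/eqP; move: x (mem_petersen_vertices x).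
by apply/allP; vm_compute.
Qed.

Lemma petersen_noC4 : ~ contains C4 petersen.
Proof.
(* Distinct vertices have at most one common neighbour, by computation, whereas the opposite corners
   [0] and [2] of a 4-cycle share both [1] and [3]. *)
have check x y : x != y ->
    count (fun z : petersen => adj x z && adj y z) petersen_vertices <= 1.
  move=> xy; apply: (implyP _ xy).
  move: y (mem_petersen_vertices y) {xy}; apply/allP.
  by move: x (mem_petersen_vertices x); apply/allP; vm_compute.
case=> f injf homf; pose o k : C4 := inord k.
have fadj i j : C4_adj (inord i) (inord j) -> adj (f (o i)) (f (o j)) by apply: homf.
have fneq i j : i < 4 -> j < 4 -> i != j -> f (o i) != f (o j).
  move=> lti ltj; apply: contraNneq => /injf/(congr1 (@nat_of_ord 4)).
  by rewrite !inordK // => ->.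
have C4E i j : i < 4 -> j < 4 -> (j == i.+1 %% 4) || (i == j.+1 %% 4) ->
    adj (f (o i)) (f (o j)).
  by move=> lti ltj ij; apply: fadj; rewrite /C4_adj -!val_eqE /= !inordK.
have := check _ _ (fneq 0 2 isT isT isT).
rewrite -card_petersen_pred => /card_le1_eqP le1.
have /eqP := fneq 1 3 isT isT isT; apply.
by apply: le1; rewrite inE !C4E.
Qed.

(** One round of breadth-first search from [r], avoiding [s]. *)
Definition grow (s r : seq petersen) :=
  [seq z <- petersen_vertices | (z \notin s) && has (fun w => (z == w) || adj w z) r].

(** That five rounds reach everything when at most two vertices are deleted is confirmed by the
    computation below. *)
Definition connected_without (s : seq petersen) :=
  if [seq z <- petersen_vertices | z \notin s] is x :: r then
    all (mem (iter 5 (grow s) [:: x])) (x :: r) else true.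

Lemma petersen_connected_without s : size s <= 2 -> connected_without s.
Proof.
pose V := petersen_vertices.
have check : connected_without [::] && all (fun u => connected_without [:: u] &&
   all (fun v => connected_without [:: u; v]) V) V by vm_compute.
have {check}/andP[check0 /allP check] := check.
case: s => [//|u [|v [|//]]] _;
  have /andP[check1 /allP check2] := check u (mem_petersen_vertices u).
  exact: check1.
exact/check2/mem_petersen_vertices.
Qed.

Lemma grow_connect (U : {set petersen}) x n z : x \notin U ->
  z \in iter n (grow (enum U)) [:: x] ->
  (z \notin U) && connect (induced_adj (~: U)) x z.
Proof.
move=> Ux; elim: n z => [|n IHn] z; first by rewrite inE => /eqP->; rewrite Ux connect0.
rewrite iterS mem_filter mem_enum => /andP[/andP[Uz /hasP[w /IHn/andP[Uw xw] wz]] _].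
rewrite Uz; case/predU1P: wz => [->//|wz]; apply: connect_trans xw (connect1 _).
by rewrite /induced_adj !in_setC Uw Uz.
Qed.

Lemma petersen_connectivity : vertex_connectivity petersen = 3.
Proof.
have cardV : #|petersen| = 10 by rewrite card_prod card_bool card_ord.
apply/eqP; rewrite eqn_leq; apply/andP; split.
  (* The three neighbours of [x] cut it off from the other vertices, such as [(true, 1)]. *)
  pose x : petersen := (false, ord0).
  rewrite -(petersen_regular x); apply: vertex_connectivity_le; apply/orP; left.
  apply: (@disconnected_of_closed _ _ [set x] x (true, lift ord0 ord0)).
  - move=> w /set1P->; apply/subsetP=> z /setIP[]; rewrite !inE.
    by move=> ->.
  - by rewrite !inE.
  - by rewrite !inE.
have [U cutU <-] := vertex_connectivity_attained petersen.
rewrite leqNgt; apply/negP => ltU; move: cutU.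
have := petersen_connected_without (s := enum U).
rewrite -cardE => /(_ ltU); rewrite /connected_without.
have := cardsC U; rewrite cardV => cardU conn.
case/orP; last by move/eqP; lia.
case/exists_inP=> x Ux /exists_inP[y Uy /negP[]].
have inL z : z \in ~: U -> z \in [seq z <- petersen_vertices | z \notin enum U].
  by move=> Uz; rewrite mem_filter mem_enum mem_petersen_vertices andbT -in_setC.
case LE: [seq _ <- _ | _] conn (inL x Ux) (inL y Uy) => [//|w r] /allP reach wx wy.
have Uw : w \notin U.
  have : w \in w :: r by rewrite mem_head.
  by rewrite -LE mem_filter mem_enum => /andP[].
have /andP[_ cx] := grow_connect Uw (reach x wx).
have /andP[_ cy] := grow_connect Uw (reach y wy).
have csym : connect_sym (induced_adj (~: U)) by apply/sym_connect_sym/induced_adj_sym.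
by apply: connect_trans cy; rewrite csym.
Qed.

(* Exhaustive search: [cs] lists the vertices already coloured and [vs] the
   others.  Conditionals stand for conjunctions because [vm_compute] evaluates
   both arguments of [&&]. *)
Fixpoint no_b_extension k (cs : seq (petersen * nat)) (vs : seq petersen) : bool :=
  if vs is v :: vs' then
    all (fun i => if has (fun p => if p.2 == i then adj v p.1 else false) cs then true
                  else no_b_extension k ((v, i) :: cs) vs') (iota 0 k)
  else
    ~~ all (fun i => has (fun p => if p.2 == i then
         all (fun j => if j == i then true else
              has (fun q => if q.2 == j then adj p.1 q.1 else false) cs) (iota 0 k)
         else false) cs) (iota 0 k).

(** The search branch that follows [c] is never pruned, since [c] is proper, and at its end the
    b-vertices of [c] refute the final test. *)
Lemma no_b_extensionP k (c : {ffun petersen -> 'I_k}) us vs :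
  b_coloring c -> (forall v, v \in us ++ vs) ->
  no_b_extension k [seq (v, val (c v)) | v <- us] vs = false.
Proof.
case/andP=> /forallP pc /forallP bc.
elim: vs us => [|v vs IHvs] us all_uv; apply/negbTE => /=.
  rewrite negbK; apply/allP => i; rewrite mem_iota => /= lti.
  have /existsP[x /andP[/eqP cx /forallP xj]] := bc (Ordinal lti).
  apply/hasP; exists (x, val (c x)); first by apply: map_f; have := all_uv x; rewrite cats0.
  rewrite /= cx eqxx; apply/allP => j; rewrite mem_iota => /= ltj.
  case: eqP => // /eqP ji.
  have /existsP[y /andP[xy /eqP cy]] := implyP (xj (Ordinal ltj)) ji.
  apply/hasP; exists (y, val (c y)); first by apply: map_f; have := all_uv y; rewrite cats0.
  by rewrite /= cy eqxx.
apply/negP => /allP/(_ (val (c v))); rewrite mem_iota ltn_ord => /(_ isT).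
case: ifP => [/hasP[_ /mapP[u uu ->] /=]|_].
  case: eqP => // /val_inj cuv vu.
  by have := implyP (forallP (pc v) u) vu; rewrite cuv eqxx.
rewrite -[_ :: _]/[seq (v, val (c v)) | v <- v :: us] IHvs // => w.
by have := all_uv w; rewrite !mem_cat !inE orbCA orbA.
Qed.

Lemma petersen_not_b_colorable4 : ~~ b_colorable petersen 4.
Proof.
apply/existsP => -[c bc].
(* Permuting the colours fixes those of two adjacent vertices, which makes the
   search twelve times shorter. *)
pose x : petersen := (false, ord0); pose y : petersen := (true, ord0).
pose i0 : 'I_4 := ord0; pose i1 : 'I_4 := lift ord0 ord0.
pose c1 := [ffun v => tperm (c x) i0 (c v)].
have bc1 : b_coloring c1 by apply: b_coloring_perm.
pose c2 := [ffun v => tperm (c1 y) i1 (c1 v)].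
have bc2 : b_coloring c2 by apply: b_coloring_perm.
have c1x : c1 x = i0 by rewrite ffunE tpermL.
have c2y : c2 y = i1 by rewrite ffunE tpermL.
have c1y : c1 y != i0.
  rewrite -c1x; have /andP[/forallP/(_ y)/forallP/(_ x) c1xy _] := bc1.
  exact: (implyP c1xy).
(* The second transposition exchanges [c1 y] and [i1], both different from [i0], and so leaves the
   colour of [x] alone. *)
have c2x : c2 x = i0 by rewrite ffunE c1x tpermD.
pose vs := [seq v <- petersen_vertices | (v != x) && (v != y)].
have check : no_b_extension 4 [:: (x, val i0); (y, val i1)] vs by vm_compute.
have /negbT/negP[] : no_b_extension 4 [:: (x, val i0); (y, val i1)] vs = false.
  rewrite -c2x -c2y; apply: (no_b_extensionP (us := [:: x; y]) bc2) => v.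
  rewrite mem_cat mem_filter mem_petersen_vertices andbT -negb_or !in_cons orbF.
  exact: orbN.
exact: check.
Qed.

Local Open Scope ring_scope.

Theorem theorem5 :
  (forall (d : nat) (G : sgraph),
     regular d G -> ~ contains C4 G ->
     (vertex_connectivity G)%:R <= (d%:R + 1) / 2%:R :> rat ->
     b_chromatic_number G = (d + 1)%N)
  /\ (regular 3 petersen
      /\ ~ contains C4 petersen
      /\ (vertex_connectivity petersen)%:R = (3%:R + 1) / 2%:R + 1 :> rat
      /\ vertex_connectivity petersen = 3%N
      /\ b_chromatic_number petersen <> (3 + 1)%N).
Proof.
split=> [d G regG noC4|].
  rewrite ler_pdivlMr ?ltr0n // -natrM natr1 ler_nat mulnC => le_kappa.
  by rewrite addn1; apply/(b_chromatic_numberE regG)/b_colorable_of_connectivity.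
split; first exact: petersen_regular.
split; first exact: petersen_noC4.
split; first by rewrite petersen_connectivity; apply/eqP.
split; first exact: petersen_connectivity.
move=> phi4; have := b_chromatic_number_attained (G := petersen).
by rewrite phi4 (negPf petersen_not_b_colorable4) => /(_ isT).
Qed.
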